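(* Let $q\in(0,1)$ and let $n\ge 1$ be an integer. Then for every real $z$ with $0<z<1$, $$\frac{1-q^{n+1}}{1-q^{n+2}}\,\bigl(I_{n}(q;z)\bigr)^{2}<I_{n-1}(q;z)\,I_{n+1}(q;z)<\bigl(I_{n}(q;z)\bigr)^{2}.$$ Moreover, the constant $\frac{1-q^{n+1}}{1-q^{n+2}}$ is best possible in the left-hand inequality; that is, for fixed $q$ and $n$ it is the largest real number $c$ such that $c\,(I_n(q;z))^2<I_{n-1}(q;z)I_{n+1}(q;z)$ holds for all $z\in(0,1)$.
   Context: For $q\in(0,1)$, the $q$-shifted factorials are $(q;q)_0=1$ and $(q;q)_n=\prod_{k=1}^{n}(1-q^{k})$ for $n\ge 1$. The $q$-exponential function $e(q;z)$ is defined for $|z|<1$ by $$e(q;z)=\sum_{k=0}^{\infty}\frac{z^{k}}{(q;q)_{k}}.$$ For an integer $n\ge 0$ and $0<z<1$, its remainder is $$I_n(q;z)=e(q;z)-\sum_{k=0}^{n}\frac{z^{k}}{(q;q)_{k}}.$$ *)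

(* Defs.v *)
From mathcomp Require Import all_boot all_order all_algebra.
From mathcomp Require Import all_classical all_reals all_analysis.
Set Implicit Arguments.
Unset Strict Implicit.
Unset Printing Implicit Defensive.
Import Order.TTheory GRing.Theory Num.Theory.
Import numFieldNormedType.Exports.
Local Open Scope ring_scope.

Definition qfact (R : realType) (q : R) (n : nat) : R :=
  \prod_(1 <= k < n.+1) (1 - q ^+ k).

(* A total function: the sum of the series for 0 < q < 1 and |z| < 1, where it
   converges, and a junk value wherever it diverges. *)
Definition qexp (R : realType) (q z : R) : R :=
  limn [series z ^+ k / qfact q k]_k.

Definition qexp_rem (R : realType) (n : nat) (q z : R) : R :=
  qexp q z - \sum_(0 <= k < n.+1) z ^+ k / qfact q k.

(* Main.v *)
(** Write [a_k = 1 / (q;q)_k] and [S_m(z) = \sum_j a_(m+j) z^j], so that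
    [I_(m-1) = z^m S_m] and the claim compares [S_n S_(n+2)] with [S_(n+1)^2].

    Since [S_m = a_m + z S_(m+1)], the right-hand inequality is equivalent to
    [a_n S_(n+1) < a_(n+1) S_n], which holds coefficientwise because
    [a_(k+1) / a_k = 1 / (1 - q^(k+1))] is decreasing in [k].

    The ratios [a_k a_(k+2) / a_(k+1)^2 = (1 - q^(k+1)) / (1 - q^(k+2))] increase
    with [k], so with [b] the ratio at [k = n], the coefficients of [S_n], [S_(n+1)],
    [S_(n+2)] satisfy [b t_j^2 <= u_j v_j], strictly for [j = 1].  Summing over [j]
    by the Cauchy-Schwarz inequality gives the left-hand inequality.  Letting
    [z] tend to [0], where [S_m] tends to [a_m], shows that [b] is optimal. *)

Require Import Defs.
From mathcomp Require Import all_boot all_order all_algebra.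
From mathcomp Require Import all_classical all_reals all_analysis.
From mathcomp Require Import ring lra.
Import Order.TTheory GRing.Theory Num.Theory.
Import numFieldNormedType.Exports.
Local Open Scope ring_scope.

Section qexp_remainder.
Local Open Scope classical_set_scope.
Local Open Scope ring_scope.

(** * Limits of series *)

Lemma lim_series_lt (R : realFieldType) (f g : R ^nat) (i : nat) :
  cvgn (series f) -> cvgn (series g) -> (forall n, f n <= g n) -> f i < g i ->
  limn (series f) < limn (series g).
Proof.
move=> cf cg fg fgi; rewrite -subr_gt0 -lim_seriesB//.
have d0 n : 0 <= (g - f) n by rewrite subr_ge0.
(* The partial sum through index [i] is already positive, and the remaining terms cannot decrease
   it. *)
apply: (@lt_le_trans _ _ (series (g - f) i.+1)).
  rewrite seriesSr ltr_wpDl ?subr_gt0//.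
  by rewrite seriesEnat/= sumr_ge0.
apply: nondecreasing_cvgn_le; last exact: is_cvg_seriesB.
exact: nondecreasing_series.
Qed.

Lemma is_cvg_seriesMl (R : realFieldType) (f : R ^nat) (c : R) :
  cvgn (series f) -> cvgn (series (fun j => c * f j)).
Proof. exact: is_cvg_seriesZ. Qed.

Lemma lim_seriesMl (R : realFieldType) (f : R ^nat) (c : R) :
  cvgn (series f) -> limn (series (fun j => c * f j)) = c * limn (series f).
Proof. exact: lim_seriesZ. Qed.

Lemma lim_series_recl (R : realFieldType) (f : R ^nat) :
  cvgn (series f) -> limn (series f) = f 0%N + limn (series (fun n => f n.+1)).
Proof.
move=> cf.
have E n : series f n.+1 = f 0%N + series (fun n => f n.+1) n.
  by rewrite !seriesEnat/= big_nat_recl.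
have cS : (fun n => series f n.+1) @ \oo --> limn (series f).
  by rewrite (cvg_shiftS (series f)).
have cg : series (fun n => f n.+1) @ \oo --> limn (series f) - f 0%N.
  rewrite (_ : series _ = fun n => series f n.+1 - f 0%N).
    by apply: cvgB => //; exact: cvg_cst.
  by apply/funext => n; rewrite E addrC addKr.
by rewrite (cvg_lim _ cg)// addrC subrK.
Qed.

Context {R : realType}.
Variable q : R.
Hypotheses (hq0 : 0 < q) (hq1 : q < 1).

(** * The coefficients [a_k], here [qcoef k] *)

Lemma qfactS k : qfact q k.+1 = qfact q k * (1 - q ^+ k.+1).
Proof. by rewrite /qfact big_nat_recr. Qed.

Lemma onem_expr_gt0 k : 0 < 1 - q ^+ k.+1.
Proof. by rewrite subr_gt0 exprn_ilt1// ltW. Qed.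

Lemma onem_expr_lt i j : (i < j)%N -> 1 - q ^+ i < 1 - q ^+ j.
Proof. by move=> ij; rewrite ltrD2l ltrN2 ltr_iXn2l. Qed.

Lemma qfact_gt0 k : 0 < qfact q k.
Proof.
elim: k => [|k IH]; first by rewrite /qfact big_geq.
by rewrite qfactS mulr_gt0// onem_expr_gt0.
Qed.

Definition qcoef k : R := (qfact q k)^-1.

Lemma qcoef_gt0 k : 0 < qcoef k.
Proof. by rewrite invr_gt0 qfact_gt0. Qed.

Lemma qcoefE k : qcoef k = (1 - q ^+ k.+1) * qcoef k.+1.
Proof.
rewrite /qcoef qfactS invfM mulrCA divff ?mulr1//.
by rewrite gt_eqF// onem_expr_gt0.
Qed.

(** [qcoefE] exposes the common factor [qcoef n.+1 * qcoef m.+1], leaving only powers of [q] to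
    compare. *)
Lemma qcoef_ratio_decr n m : (n < m)%N ->
  qcoef n * qcoef m.+1 < qcoef n.+1 * qcoef m.
Proof.
move=> nm; rewrite (qcoefE n) (qcoefE m).
rewrite -mulrA [ltRHS]mulrCA ltr_pM2r ?mulr_gt0 ?qcoef_gt0//.
by rewrite onem_expr_lt.
Qed.

Let b n := (1 - q ^+ n.+1) / (1 - q ^+ n.+2).

Lemma qcoef_log_ratio n : b n * qcoef n.+1 ^+ 2 = qcoef n * qcoef n.+2.
Proof.
rewrite (qcoefE n) (qcoefE n.+1) /b; field.
by rewrite gt_eqF// onem_expr_gt0.
Qed.

Lemma qcoef_log_ratio_incr n k : (n < k)%N ->
  b n * qcoef k.+1 ^+ 2 < qcoef k * qcoef k.+2.
Proof.
move=> nk; rewrite -qcoef_log_ratio ltr_pM2r ?exprn_gt0 ?qcoef_gt0//.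
rewrite ltr_pdivrMr ?onem_expr_gt0// mulrAC ltr_pdivlMr ?onem_expr_gt0//.
have := @onem_expr_lt n.+1 k.+1 nk.
rewrite [q ^+ n.+2]exprS [q ^+ k.+2]exprS.
move: (q ^+ n.+1) (q ^+ k.+1) => y w h.
(* Cross-multiplied, the goal is [(1 - y) * (1 - q * w) < (1 - w) * (1 - q * y)], whose sides differ
   by exactly this product. *)
have yw : 0 < (y - w) * (1 - q) by rewrite mulr_gt0 ?subr_gt0// -ltrN2 -(ltrD2l 1).
nra.
Qed.

(** * The tails [S_m], here [qtail m], and the remainders *)

Definition qtail m (z : R) : R := limn (series (fun j => qcoef (m + j) * z ^+ j)).

(** Ratio test: the ratio of consecutive terms, [z / (1 - q ^+ k.+1)] with [k = m + j], tends to
    [z], hence is eventually at most the midpoint [r] of [z] and 1. *)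
Lemma cvg_qtail m z : 0 < z -> z < 1 ->
  cvgn (series (fun j => qcoef (m + j) * z ^+ j)).
Proof.
move=> z0 z1; pose r := (1 + z) / 2.
have [N qN] : exists N, forall k, (N <= k)%N -> z <= r * (1 - q ^+ k.+1).
  have : (GRing.exp q : R ^nat) @ \oo --> 0 by apply: cvg_expr; rewrite gtr0_norm.
  (* The threshold is [r - z]; it suffices because [r < 1]. *)
  move=> /cvgr0_norm_lt /(_ ((1 - z) / 2)) [|N _ HN]; first by lra.
  exists N => k Nk; have := HN k.+1 (leqW Nk).
  rewrite /= gtr0_norm ?exprn_gt0// => qk.
  have := exprn_gt0 k.+1 hq0; rewrite /r; nra.
have r0 : 0 < r by rewrite /r; lra.
pose f j := qcoef (m + j) * z ^+ j.
have f0 j : 0 <= f j by rewrite mulr_ge0 ?exprn_ge0 ?ltW ?qcoef_gt0.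
have fr0 j : 0 <= f j / r ^+ j by rewrite divr_ge0// exprn_ge0// ltW.
(* [C] dominates each [f j / r ^+ j] with [j <= N]; beyond [N] the ratio bound propagates the
   estimate. *)
pose C := \sum_(j < N.+1) f j / r ^+ j.
have fC j : f j <= C * r ^+ j.
  have [jN|] := ltnP j N.+1.
    rewrite -ler_pdivrMr ?exprn_gt0//.
    by rewrite /C (bigD1 (Ordinal jN))//= lerDl sumr_ge0.
  elim: j => // j IH; rewrite ltnS => Nj.
  have {}IH : f j <= C * r ^+ j.
    move: Nj; rewrite leq_eqVlt => /predU1P[<-|/IH//].
    rewrite -ler_pdivrMr ?exprn_gt0//.
    by rewrite /C (bigD1 ord_max)//= lerDl sumr_ge0.
  apply: (@le_trans _ _ (f j * r)); last by rewrite exprSr [leRHS]mulrA ler_pM2r.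
  rewrite /f (qcoefE (m + j)) addnS exprSr mulrA [leRHS]mulrAC.
  rewrite -mulrA -[leRHS]mulrA.
  have := qN (m + j)%N (leq_trans Nj (leq_addl _ _)).
  have : 0 < qcoef (m + j).+1 * z ^+ j by rewrite mulr_gt0 ?exprn_gt0 ?qcoef_gt0.
  nra.
apply: (@series_le_cvg _ _ (geometric C r)) => //.
  by move=> j; rewrite mulr_ge0 ?exprn_ge0 ?(ltW r0)// sumr_ge0.
by apply: is_cvg_geometric_series; rewrite gtr0_norm// /r; lra.
Qed.

Lemma qtail_rec m z : 0 < z -> z < 1 -> qtail m z = qcoef m + z * qtail m.+1 z.
Proof.
move=> z0 z1; rewrite /qtail lim_series_recl ?addn0 ?expr0 ?mulr1; last exact: cvg_qtail.
congr (_ + _); rewrite -[RHS]lim_seriesMl; last exact: cvg_qtail.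
congr (limn (series _)); apply/funext => j /=.
rewrite addnS exprS.
by rewrite mulrCA addSn.
Qed.

(** Each term subtracted from [qexp q z = qtail 0 z] is the head that [qtail_rec] splits off. *)
Lemma qexp_rem_tail m z : 0 < z -> z < 1 ->
  qexp_rem m q z = z ^+ m.+1 * qtail m.+1 z.
Proof.
move=> z0 z1; rewrite /qexp_rem.
have -> : qexp q z = qtail 0 z.
  congr (limn (series _)); apply/funext => j /=.
  by rewrite add0n mulrC.
elim: m => [|m IH].
  by rewrite big_nat1 qtail_rec// expr0 expr1 mul1r -/(qcoef 0) addrC addKr.
rewrite big_nat_recr//= opprD addrA IH qtail_rec// -/(qcoef m.+1) [z ^+ m.+2]exprS.
ring.
Qed.

Lemma qtail_gt0 m z : 0 < z -> z < 1 -> 0 < qtail m z.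
Proof.
move=> z0 z1; pose f j := qcoef (m + j) * z ^+ j.
have f0 j : 0 < f j by rewrite mulr_gt0 ?exprn_gt0 ?qcoef_gt0.
apply: (@lt_le_trans _ _ (series f 1)); first by rewrite seriesEnat/= big_nat1.
apply: nondecreasing_cvgn_le; last exact: cvg_qtail.
by apply: nondecreasing_series => j _ _; rewrite ltW.
Qed.

Lemma qtail_gt_coef m z : 0 < z -> z < 1 -> qcoef m < qtail m z.
Proof.
by move=> z0 z1; rewrite qtail_rec// ltrDl mulr_gt0// qtail_gt0.
Qed.

Lemma qtail_le m z w : 0 < z -> z <= w -> w < 1 -> qtail m z <= qtail m w.
Proof.
move=> z0 zw w1; have w0 := lt_le_trans z0 zw.
apply: lim_series_le => [||j]; [by apply: cvg_qtail => //; apply: le_lt_trans w1|exact: cvg_qtail|].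
by rewrite ler_pM2l ?qcoef_gt0// lerXn2r// nnegrE ltW.
Qed.

(** * Turán-type inequalities for the tails *)

Lemma qtail_ratio_lt n z : 0 < z -> z < 1 ->
  qcoef n * qtail n.+1 z < qcoef n.+1 * qtail n z.
Proof.
move=> z0 z1; rewrite /qtail -!lim_seriesMl; try exact: cvg_qtail.
(* Strictness comes from index 1, since the terms at index 0 are equal. *)
apply: (@lim_series_lt _ _ _ 1%N) => [||j|]; try exact/is_cvg_seriesMl/cvg_qtail.
  rewrite !mulrA ler_pM2r ?exprn_gt0//.
  case: j => [|j]; first by rewrite !addn0 mulrC.
  by rewrite ltW// addSn qcoef_ratio_decr// addnS ltnS leq_addr.
rewrite !mulrA ltr_pM2r ?exprn_gt0//.
by rewrite addSn qcoef_ratio_decr// addn1.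
Qed.

Lemma qtail_turan_upper n z : 0 < z -> z < 1 ->
  qtail n z * qtail n.+2 z < qtail n.+1 z ^+ 2.
Proof.
(* With [z S_(n+2) = S_(n+1) - a_(n+1)] and [z S_(n+1) = S_n - a_n], the gap becomes
   [a_(n+1) S_n - a_n S_(n+1)]. *)
move=> z0 z1; rewrite -(ltr_pM2l z0).
have := qtail_ratio_lt n z z0 z1.
have := qtail_rec n z z0 z1; have := qtail_rec n.+1 z z0 z1.
nra.
Qed.

(* Cauchy-Schwarz for the series in AM-GM form, to be optimised at
   [l = qtail n.+1 z / qtail n z]. *)
Lemma qtail_amgm n z l : 0 < z -> z < 1 -> 0 < l ->
  2 * l * b n * qtail n.+1 z < l ^+ 2 * b n * qtail n z + qtail n.+2 z.
Proof.
move=> z0 z1 l0; rewrite /qtail -!lim_seriesMl; try exact: cvg_qtail.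
have cZ c m : cvgn (series (fun j => c * (qcoef (m + j) * z ^+ j))).
  exact/is_cvg_seriesMl/cvg_qtail.
rewrite -lim_seriesD//; last exact: cvg_qtail.
have b0 : 0 < b n by rewrite divr_gt0 ?onem_expr_gt0.
(* Expanding the square gives [2 l b t v <= l^2 b^2 t^2 + v^2 <= l^2 b u v + v^2]; then [v]
   cancels. *)
have amgm (t u v : R) : 0 < t -> 0 < u -> 0 < v -> b n * t ^+ 2 <= u * v ->
    2 * l * b n * t <= l ^+ 2 * b n * u + v.
  move=> t0 u0 v0 tuv.
  have : 0 <= (l * b n * t - v) ^+ 2 by exact: sqr_ge0.
  have l2 : 0 < l ^+ 2 * b n by rewrite mulr_gt0 ?exprn_gt0.
  rewrite -(ler_pM2l v0) => sq.
  have := ler_wpM2l (ltW l2) tuv.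
  nra.
have amgm_lt (t u v : R) : 0 < t -> 0 < u -> 0 < v -> b n * t ^+ 2 < u * v ->
    2 * l * b n * t < l ^+ 2 * b n * u + v.
  move=> t0 u0 v0 tuv.
  have : 0 <= (l * b n * t - v) ^+ 2 by exact: sqr_ge0.
  have l2 : 0 < l ^+ 2 * b n by rewrite mulr_gt0 ?exprn_gt0.
  rewrite -(ltr_pM2l v0) => sq.
  have : l ^+ 2 * b n * (b n * t ^+ 2) < l ^+ 2 * b n * (u * v) by rewrite ltr_pM2l.
  nra.
(* At index 0, [qcoef_log_ratio] is an equality, so index 1 supplies the strictness. *)
apply: (@lim_series_lt _ _ _ 1%N) => // [|j|].
- by apply: is_cvg_seriesD => //; exact: cvg_qtail.
- apply: (amgm (_ * _) (_ * _) (_ * _)); rewrite ?mulr_gt0 ?exprn_gt0 ?qcoef_gt0//.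
  rewrite [leRHS]mulrACA -expr2 exprMn [leLHS]mulrA ler_pM2r ?exprn_gt0// !addSn.
  case: j => [|j]; first by rewrite addn0 qcoef_log_ratio.
  by rewrite ltW// qcoef_log_ratio_incr// addnS ltnS leq_addr.
apply: (amgm_lt (_ * _) (_ * _) (_ * _)); rewrite ?mulr_gt0 ?exprn_gt0 ?qcoef_gt0//.
rewrite [ltRHS]mulrACA -expr2 exprMn [ltLHS]mulrA ltr_pM2r ?exprn_gt0// !addSn.
by rewrite qcoef_log_ratio_incr// addn1.
Qed.

Lemma qtail_turan_lower n z : 0 < z -> z < 1 ->
  b n * qtail n.+1 z ^+ 2 < qtail n z * qtail n.+2 z.
Proof.
move=> z0 z1; have S0 := qtail_gt0 n z z0 z1; have S1 := qtail_gt0 n.+1 z z0 z1.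
have l0 : 0 < qtail n.+1 z / qtail n z by rewrite divr_gt0.
(* Multiplied by [S_n], the bound reads [2 b S_(n+1)^2 < b S_(n+1)^2 + S_n S_(n+2)]. *)
have := qtail_amgm n z _ z0 z1 l0; rewrite -(ltr_pM2l S0).
have -> : qtail n z * (2 * (qtail n.+1 z / qtail n z) * b n * qtail n.+1 z)
    = 2 * (b n * qtail n.+1 z ^+ 2) by field; rewrite gt_eqF.
have -> : qtail n z * ((qtail n.+1 z / qtail n z) ^+ 2 * b n * qtail n z + qtail n.+2 z)
    = b n * qtail n.+1 z ^+ 2 + qtail n z * qtail n.+2 z by field; rewrite gt_eqF.
lra.
Qed.

(** The limit at 0 is made quantitative: on [z <= 1/2] the recurrence gives [S_m <= a_m + z M_m]
    with a constant [M_m], so [c > b n] fails at an explicit small [z]. *)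
Lemma qtail_turan_lower_sharp n c :
  (forall z, 0 < z -> z < 1 -> c * qtail n.+1 z ^+ 2 < qtail n z * qtail n.+2 z) ->
  c <= b n.
Proof.
move=> hc; rewrite leNgt; apply/negP => bc.
have b0 : 0 < b n by rewrite divr_gt0 ?onem_expr_gt0.
pose M m := qtail m.+1 2^-1.
have M0 m : 0 < M m by apply: qtail_gt0; lra.
have SM m z : 0 < z -> z <= 2^-1 -> qtail m z <= qcoef m + z * M m.
  move=> z0 z2; rewrite qtail_rec//; last by lra.
  by rewrite lerD2l ler_pM2l// qtail_le//; lra.
(* [d] is the violation at [z = 0]; [z * K] bounds how much the product of tails can exceed
   [a_n a_(n+2)]. *)
pose d := (c - b n) * qcoef n.+1 ^+ 2.
have d0 : 0 < d by rewrite mulr_gt0 ?subr_gt0// exprn_gt0 ?qcoef_gt0.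
pose K := qcoef n * M n.+2 + qcoef n.+2 * M n + M n * M n.+2.
have K0 : 0 < K by rewrite !addr_gt0// mulr_gt0// qcoef_gt0.
have D0 : 0 < 2 * d + K by lra.
(* This choice ensures both [z <= 1/2] and [z * K < d]. *)
have [z z0 zE] : exists2 z, 0 < z & z * (2 * d + K) = d.
  by exists (d / (2 * d + K)); rewrite ?divr_gt0// divfK// gt_eqF.
have z2 : z <= 2^-1 by rewrite -(ler_pM2r D0) zE; lra.
have z1 : z < 1 by lra.
have zK : z * K < d by nra.
have dz : d <= z * K.
  have e : qcoef n * qcoef n.+2 = b n * qcoef n.+1 ^+ 2 by rewrite qcoef_log_ratio.
  have : c * qcoef n.+1 ^+ 2 <= c * qtail n.+1 z ^+ 2.
    rewrite ler_pM2l ?(lt_trans b0)// lerXn2r ?nnegrE ?ltW ?qcoef_gt0 ?qtail_gt0//.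
    exact: qtail_gt_coef.
  have : qtail n z * qtail n.+2 z <= (qcoef n + z * M n) * (qcoef n.+2 + z * M n.+2).
    by rewrite ler_pM ?SM// ltW// qtail_gt0.
  have := hc z z0 z1; have := M0 n; have := M0 n.+2.
  (* The quadratic term is absorbed into the linear one. *)
  have : z * (M n * M n.+2) * z <= z * (M n * M n.+2).
    by apply: ler_piMr; [rewrite ltW// !mulr_gt0|exact: ltW].
  rewrite /d /K; nra.
by rewrite ltNge dz in zK.
Qed.

End qexp_remainder.

Theorem theorem1 (R : realType) (q : R) (n : nat)
    (hq0 : 0 < q) (hq1 : q < 1) (hn : (1 <= n)%N) :
  (forall z : R, 0 < z -> z < 1 ->
     (1 - q ^+ n.+1) / (1 - q ^+ n.+2) * qexp_rem n q z ^+ 2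
       < qexp_rem n.-1 q z * qexp_rem n.+1 q z
     /\ qexp_rem n.-1 q z * qexp_rem n.+1 q z < qexp_rem n q z ^+ 2)
  /\ (forall c : R,
       (forall z : R, 0 < z -> z < 1 ->
          c * qexp_rem n q z ^+ 2 < qexp_rem n.-1 q z * qexp_rem n.+1 q z) ->
       c <= (1 - q ^+ n.+1) / (1 - q ^+ n.+2)).
Proof.
(* Both products carry the power [z^(2n+2)], as [2(n+1) = n + (n+2)], so it cancels; [hn] gives
   [n.-1.+1 = n]. *)
have remE z : 0 < z -> z < 1 ->
  (qexp_rem n q z ^+ 2 = z ^+ (n + n).+2 * qtail q n.+1 z ^+ 2) *
  (qexp_rem n.-1 q z * qexp_rem n.+1 q z
    = z ^+ (n + n).+2 * (qtail q n z * qtail q n.+2 z)).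
  move=> z0 z1; rewrite !qexp_rem_tail// prednK//; split.
    by rewrite exprMn -exprM muln2 -addnn addSn addnS.
  by rewrite mulrACA -exprD !addnS.
split=> [z z0 z1|c hc].
  rewrite !remE// mulrCA !ltr_pM2l ?exprn_gt0//; split.
    exact: qtail_turan_lower.
  exact: qtail_turan_upper.
apply: (qtail_turan_lower_sharp q hq0 hq1) => z z0 z1.
by have := hc z z0 z1; rewrite !remE// mulrCA ltr_pM2l ?exprn_gt0.
Qed.
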